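(* Let $\mathcal{G}$ and $\mathcal{F}$ be two metrizable complete topological $\widetilde{\mathbb{C}}$-modules and let $T$ be a continuous surjective $\widetilde{\mathbb{C}}$-linear map from $\mathcal{G}$ onto $\mathcal{F}$. Then $T$ is a strict morphism.
   Context: Generalized numbers: $\widetilde{\mathbb{C}}=\mathcal{E}_M/\mathcal{N}$, where $\mathcal{E}_M$ is the ring of nets $(c_\varepsilon)_\varepsilon\in\mathbb{C}^{(0,1]}$ with $|c_\varepsilon|=O(\varepsilon^{-N})$ as $\varepsilon\to0$ for some $N\in\mathbb{N}$, and $\mathcal{N}$ is the ideal of nets with $|c_\varepsilon|=O(\varepsilon^{q})$ for all $q\in\mathbb{N}$. The valuation is $\mathrm{v}(c)=\sup\{b\in\mathbb{R}: |c_\varepsilon|=O(\varepsilon^b)\text{ as }\varepsilon\to0\}$ and $|c|_{\mathrm e}=e^{-\mathrm{v}(c)}$; $\widetilde{\mathbb{C}}$ carries the topology of the ultrametric $|c-d|_{\mathrm e}$. A topological $\widetilde{\mathbb{C}}$-module is a $\widetilde{\mathbb{C}}$-module with a topology making addition and scalar multiplication $\widetilde{\mathbb{C}}\times\mathcal{G}\to\mathcal{G}$ continuous (no local convexity is assumed here). A bijective continuous $\widetilde{\mathbb{C}}$-linear map between topological $\widetilde{\mathbb{C}}$-modules is an isomorphism if its inverse is continuous. An injective continuous $\widetilde{\mathbb{C}}$-linear map $T:\mathcal{G}\to\mathcal{F}$ is a strict morphism if it is an isomorphism from $\mathcal{G}$ onto $T(\mathcal{G})$ (with the topology induced by $\mathcal{F}$).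 A continuous $\widetilde{\mathbb{C}}$-linear map $T:\mathcal{G}\to\mathcal{F}$ is a strict morphism if the associated injection $\overline{T}:\mathcal{G}/\mathrm{Ker}(T)\to\mathcal{F}$ (quotient topology on $\mathcal{G}/\mathrm{Ker}(T)$) is a strict morphism. *)

(* Defs.v *)
From HB Require Import structures.
From mathcomp Require Import all_boot all_order all_algebra ring_quotient.
From mathcomp Require Import all_classical all_reals all_analysis.
From mathcomp Require Import complex.

Set Implicit Arguments.
Unset Strict Implicit.
Unset Printing Implicit Defensive.

Import Order.TTheory GRing.Theory Num.Theory.
Import numFieldNormedType.Exports.

Local Open Scope classical_set_scope.
Local Open Scope ring_scope.
Local Open Scope quotient_scope.

Definition eps_index (R : realType) : Type := {e : R | 0 < e <= 1}.

HB.instance Definition _ (R : realType) := SubChoice.on (eps_index R).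



Lemma eps_index1 (R : realType) : 0 < (1 : R) <= 1.
Proof. by rewrite ltr01 lexx. Qed.

HB.instance Definition _ (R : realType) :=
  isPointed.Build (eps_index R) (exist _ 1 (eps_index1 R)).

Definition eps_to0 (R : realType) : set_system (eps_index R) :=
  filter_from [set eta : R | 0 < eta] (fun eta => [set e | val e <= eta]).

Global Instance eps_to0_filter (R : realType) : ProperFilter (@eps_to0 R).
Proof.
apply: filter_from_proper; last first.
  move=> i /= i0; have h : 0 < Num.min i 1 <= 1.
    by rewrite lt_min i0 ltr01 ge_min lexx orbT.
  by exists (exist _ (Num.min i 1) h); rewrite /= ge_min lexx.
apply: filter_from_filter; first by exists 1 => /=.
move=> i j /= i0 j0; exists (Num.min i j); first by rewrite /= lt_min i0.
by move=> e /=; rewrite le_min => /andP.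
Qed.


Notation net R := (eps_index R -> R[i]).


Canonical eps_to0_filterType (R : realType) :=
  FilterType (@eps_to0 R) (@eps_to0_filter R).

Notation normc := ComplexField.Normc.normc.

Definition netO (R : realType) (c : net R) (b : R) : Prop :=
  (fun e => normc (c e) : R^o) =O_ (@eps_to0 R) (fun e => val e `^ b : R^o).

Section netO_theory.
Variable R : realType.
Implicit Types (c d : net R) (b : R).

Lemma normc_ge0 (z : R[i]) : 0 <= normc z.
Proof. by case: z => x y; exact: sqrtr_ge0. Qed.

Lemma netOP c b : netO c b <->
  exists2 k : R, 0 < k &
  exists2 eta : R, 0 < eta &
  forall e : eps_index R, val e <= eta -> normc (c e) <= k * val e `^ b.
Proof.
have aux (e : eps_index R) k :
    (`|(normc (c e) : R^o)| <= k * `|(val e `^ b : R^o)|) =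
    (normc (c e) <= k * val e `^ b).
  by rewrite (ger0_norm (powR_ge0 _ _)) ger0_norm// normc_ge0.
rewrite /netO eqO_exP; split=> -[k k0 [eta eta0 H]]; exists k => //;
  by exists eta => // e he; have := H e he; rewrite /= aux.
Qed.

Lemma eps_index_gt0 (e : eps_index R) : 0 < val e.
Proof. by case: e => e /= /andP[]. Qed.

Lemma eps_index_le1 (e : eps_index R) : val e <= 1.
Proof. by case: e => e /= /andP[]. Qed.

Lemma netO_le c b b' : b' <= b -> netO c b -> netO c b'.
Proof.
move=> bb' /netOP[k k0 [eta eta0 H]]; apply/netOP; exists k => //.
exists eta => // e /H/le_trans; apply; rewrite ler_pM2l//.
by apply: ger_powR => //; rewrite eps_index_gt0 eps_index_le1.
Qed.

Lemma netO0 b : netO (0 : net R) b.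
Proof.
apply/netOP; exists 1 => //; exists 1 => // e _.
by rewrite mul1r [leLHS](_ : _ = 0) ?powR_ge0//; exact: ComplexField.Normc.normc0.
Qed.

Lemma netOD c d b : netO c b -> netO d b -> netO (c + d) b.
Proof.
move=> /netOP[k k0 [eta eta0 H]] /netOP[k' k'0 [eta' eta'0 H']].
apply/netOP; exists (k + k'); first exact: addr_gt0.
exists (Num.min eta eta'); first by rewrite lt_min eta0.
move=> e; rewrite le_min => /andP[/H + /H'] => h h'.
by rewrite mulrDl (le_trans (le_normcD _ _))// lerD.
Qed.

Lemma netON c b : netO c b -> netO (- c) b.
Proof.
move=> /netOP[k k0 [eta eta0 H]]; apply/netOP; exists k => //; exists eta => //.
by move=> e /H; rewrite [X in _ -> X <= _](_ : _ = normc (c e))//; exact: normcN.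
Qed.

Lemma netOB c d b : netO c b -> netO d b -> netO (c - d) b.
Proof. by move=> hc /netON; exact: netOD. Qed.

Lemma netOM c d b b' : netO c b -> netO d b' -> netO (c * d) (b + b').
Proof.
move=> /netOP[k k0 [eta eta0 H]] /netOP[k' k'0 [eta' eta'0 H']].
apply/netOP; exists (k * k'); first exact: mulr_gt0.
exists (Num.min eta eta'); first by rewrite lt_min eta0.
move=> e; rewrite le_min => /andP[/H + /H'] => h h'.
rewrite powRD; last by rewrite (gt_eqF (eps_index_gt0 e)) implybT.
rewrite mulrACA [leLHS](_ : _ = normc (c e) * normc (d e)).
  by rewrite ler_pM// ?normc_ge0.
exact: ComplexField.Normc.normcM.
Qed.

Lemma netO1 : netO (1 : net R) 0.
Proof.
apply/netOP; exists 1 => //; exists 1 => // e _.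
by rewrite powRr0 mulr1 [leLHS](_ : _ = 1)//; exact: ComplexField.Normc.normc1.
Qed.

Lemma netO1N : ~ netO (1 : net R) 1.
Proof.
move=> /netOP[k k0 [eta eta0 H]].
pose t := Num.min (Num.min eta 1) (2 * k)^-1.
have t0 : 0 < t by rewrite !lt_min eta0 ltr01 invr_gt0 mulr_gt0.
have t1 : 0 < t <= 1 by rewrite t0 !ge_min lexx orbT.
have := H (exist _ t t1); rewrite /= !ge_min lexx => /(_ isT).
rewrite [leLHS](_ : _ = 1) ?powRr1 ?(ltW t0)//; last first.
  exact: ComplexField.Normc.normc1.
apply/negP; rewrite -ltNge.
rewrite (@le_lt_trans _ _ (k * (2 * k)^-1))//.
  by rewrite ler_pM2l// !ge_min lexx orbT.
by rewrite invfM mulrCA divff ?gt_eqF// mulr1 invf_lt1// ltr1n.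
Qed.

End netO_theory.

Definition moderate (R : realType) : {pred net R} :=
  fun c => `[< exists N : nat, netO c (- N%:R) >].

Lemma moderateP (R : realType) (c : net R) :
  reflect (exists N : nat, netO c (- N%:R)) (c \in @moderate R).
Proof. exact: asboolP. Qed.

Lemma moderate_subring_closed (R : realType) : subring_closed (@moderate R).
Proof.
split.
- by apply/moderateP; exists 0%N; rewrite oppr0; exact: netO1.
- move=> c d /moderateP[N cN] /moderateP[M dM]; apply/moderateP.
  exists (maxn N M); apply: netOB.
    by apply: netO_le cN; rewrite lerN2 ler_nat leq_maxl.
  by apply: netO_le dM; rewrite lerN2 ler_nat leq_maxr.
- move=> c d /moderateP[N cN] /moderateP[M dM]; apply/moderateP.
  by exists (N + M)%N; rewrite natrD opprD; exact: netOM.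
Qed.

HB.instance Definition _ (R : realType) :=
  GRing.isSubringClosed.Build (net R) (@moderate R) (@moderate_subring_closed R).

Definition EM (R : realType) : Type := {c : net R | c \in @moderate R}.

HB.instance Definition _ (R : realType) := SubChoice.on (EM R).
HB.instance Definition _ (R : realType) :=
  [SubChoice_isSubComNzRing of EM R by <:].

Definition negligible (R : realType) : {pred EM R} :=
  fun c => `[< forall q : nat, netO (val c) q%:R >].

Lemma negligibleP (R : realType) (c : EM R) :
  reflect (forall q : nat, netO (val c) q%:R) (c \in @negligible R).
Proof. exact: asboolP. Qed.

Lemma negligible_idealr_closed (R : realType) : idealr_closed (@negligible R).
Proof.
split.
- by apply/negligibleP => q; rewrite raddf0; exact: netO0.
- by apply/negligibleP => /(_ 1%N); rewrite rmorph1; exact: netO1N.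
- move=> a c d /negligibleP Hc /negligibleP Hd; apply/negligibleP => q.
  rewrite rmorphD rmorphM /=; apply: netOD => //.
  have /moderateP[N aN] := valP a.
  have -> : q%:R = - N%:R + (N + q)%:R :> R by rewrite natrD addKr.
  exact: netOM.
Qed.

HB.instance Definition _ (R : realType) :=
  isIdealr.Build (EM R) (@negligible R) (@negligible_idealr_closed R).

(* The ring of generalized complex numbers E_M / N. *)
Definition Ct (R : realType) : Type := {ideal_quot (@negligible R)}.

HB.instance Definition _ (R : realType) := GRing.ComNzRing.on (Ct R).
HB.instance Definition _ (R : realType) := EqQuotient.on (Ct R).

Definition net_valuation (R : realType) (c : net R) : \bar R :=
  ereal_sup [set b%:E | b in [set b : R | netO c b]].

Definition valuation (R : realType) (x : Ct R) : \bar R :=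
  net_valuation (val (repr x)).

(* exp (- v(x)); expeR (-oo) = 0, so enorm 0 = 0. *)
Definition enorm (R : realType) (x : Ct R) : R :=
  fine (expeR (- valuation x)%E).

Section valuation_theory.
Variable R : realType.
Implicit Types (u : EM R) (x y : Ct R).

Lemma netO_negligible u1 u2 b :
  u1 - u2 \in @negligible R -> netO (val u2) b -> netO (val u1) b.
Proof.
move=> /negligibleP h h2; rewrite -(subrK u2 u1) rmorphD.
apply: netOD => //; have [q /ltW qb] : exists q : nat, b < q%:R.
  by exists (Num.bound `|b|); rewrite (le_lt_trans (ler_norm b))// archi_boundP.
exact: netO_le qb (h q).
Qed.

(* The valuation does not depend on the chosen representative. *)
Lemma valuation_pi u : valuation (\pi_(Ct R) u) = net_valuation (val u).
Proof.
rewrite /valuation; set w := repr _.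
have e : w = u %[mod Ct R] by rewrite reprK.
have h1 : w - u \in @negligible R by rewrite Quotient.idealrBE; apply/eqP.
have h2 : u - w \in @negligible R by rewrite -opprB rpredN.
rewrite /net_valuation; congr (ereal_sup (image _ _)).
by apply/seteqP; split => b /=; exact: netO_negligible.
Qed.

Lemma lt_valuation u b : (b%:E < net_valuation (val u))%E -> netO (val u) b.
Proof.
move=> /ereal_sup_gt[_ [b' hb' <-]]; rewrite lte_fin => /ltW bb'.
exact: netO_le bb' hb'.
Qed.

Lemma le_valuation u b : netO (val u) b -> (b%:E <= net_valuation (val u))%E.
Proof. by move=> h; apply: ereal_sup_ubound; exists b. Qed.

Lemma valuation_gtNy x : (-oo < valuation x)%E.
Proof.
have /moderateP[N hN] := valP (repr x).
by rewrite (lt_le_trans _ (le_valuation hN)) ?ltNyr.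
Qed.


Lemma valuation_eqy x : valuation x = +oo%E <-> x = 0.
Proof.
elim/quotW: x => u; have <- : \pi_(Ct R) 0 = 0 by rewrite raddf0.
split=> [|->]; rewrite valuation_pi.
  move=> h; apply/eqP; rewrite -Quotient.idealrBE subr0; apply/negligibleP => q.
  by apply: lt_valuation; rewrite h ltry.
rewrite raddf0; apply: eq_infty => b; apply: (@le_valuation 0).
by rewrite raddf0; exact: netO0.
Qed.

Lemma valuationN x : valuation (- x) = valuation x.
Proof.
elim/quotW: x => u; rewrite -raddfN !valuation_pi raddfN.
rewrite /net_valuation; congr (ereal_sup (image _ _)).
by apply/seteqP; split => b /= /netON; rewrite ?opprK.
Qed.

Lemma enormE x : (enorm x)%:E = expeR (- valuation x)%E.
Proof.
rewrite /enorm fineK//; have := valuation_gtNy x.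
by case: (valuation x).
Qed.

Lemma enorm0 : enorm (0 : Ct R) = 0.
Proof. by rewrite /enorm (valuation_eqy 0).2. Qed.

Lemma enorm_eq0 x : enorm x = 0 -> x = 0.
Proof.
move=> x0; apply/valuation_eqy/eqP.
by rewrite -eqe_opp -expeR_eq0 -enormE x0.
Qed.

Lemma enormN x : enorm (- x) = enorm x.
Proof. by rewrite /enorm valuationN. Qed.

Lemma lee_dense (a z : \bar R) :
  (forall b : R, (b%:E < a -> b%:E <= z)%E) -> (a <= z)%E.
Proof.
case: a => [r| |] H; last by rewrite leNye.
  by apply/lee_subgt0Pr => e e0; apply: H; rewrite lte_fin ltrBlDr ltrDl.
by rewrite (@eq_infty _ z)// => b; apply: H; exact: ltry.
Qed.

Lemma enormD x y : enorm (x + y) <= Num.max (enorm x) (enorm y).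
Proof.
have h x' y' : (valuation x' <= valuation y')%E -> enorm (x' + y') <= enorm x'.
  elim/quotW: x' => u; elim/quotW: y' => w uw.
  rewrite -lee_fin !enormE lee_expeR leeN2 -raddfD.
  move: uw; rewrite !valuation_pi => uw; apply: lee_dense => b bu.
  apply: le_valuation; rewrite raddfD; apply: netOD; apply: lt_valuation => //.
  exact: lt_le_trans uw.
have [xy|/ltW yx] := leP (valuation x) (valuation y).
  by rewrite le_max h.
by rewrite le_max addrC (h y x)// orbT.
Qed.

Definition edist x y : R := enorm (x - y).

Lemma edistxx x : edist x x = 0.
Proof. by rewrite /edist subrr enorm0. Qed.

Lemma edist_eq0 x y : edist x y = 0 -> x = y.
Proof. by move=> /enorm_eq0/eqP; rewrite subr_eq0 => /eqP. Qed.

Lemma edist_sym x y : edist x y = edist y x.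
Proof. by rewrite /edist -enormN opprB. Qed.

Lemma enorm_ge0 x : 0 <= enorm x.
Proof. by rewrite -lee_fin enormE expeR_ge0. Qed.

Lemma edist_triangle y x z : edist x z <= edist x y + edist y z.
Proof.
rewrite /edist -(subrKA y x (- z)) (le_trans (enormD _ _))//.
by rewrite ge_max lerDl lerDr !enorm_ge0.
Qed.

End valuation_theory.

HB.instance Definition _ (R : realType) := isMetric.Build R (Ct R)
  (@edistxx R) (@edist_eq0 R) (@edist_sym R) (@edist_triangle R).

Lemma Ct_ballE (R : realType) (x : Ct R) (r : R) :
  ball x r = [set y | enorm (x - y) < r].
Proof. by []. Qed.


(* The library's topologicalLmodType requires scalars in a numDomainType, which
   Ct is not, and HB rejects a new structure over Ct that joins a topology and an
   Lmodule.  Topological modules are therefore bundled by hand: first a module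
   with a family of open sets, then the continuity of the two operations.  As
   -x = (-1) *: x, continuity of the opposite need not be required. *)
Record preTopCtModType (R : realType) := PreTopCtModType {
  tcm_lmod : lmodType (Ct R);
  tcm_open : set_system tcm_lmod;
  tcm_openT : tcm_open setT;
  tcm_openI : forall A B, tcm_open A -> tcm_open B -> tcm_open (A `&` B);
  tcm_open_bigcup : forall (I : Type) (f : I -> set tcm_lmod),
    (forall i, tcm_open (f i)) -> tcm_open (\bigcup_i f i)
}.

Definition tcm_sort (R : realType) (M : preTopCtModType R) : Type := tcm_lmod M.
Coercion tcm_sort : preTopCtModType >-> Sortclass.

HB.instance Definition _ (R : realType) (M : preTopCtModType R) :=
  GRing.Lmodule.on (tcm_sort M).
HB.instance Definition _ (R : realType) (M : preTopCtModType R) :=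
  @isOpenTopological.Build (tcm_sort M) (@tcm_open R M)
    (@tcm_openT R M) (@tcm_openI R M) (@tcm_open_bigcup R M).

Record topCtModType (R : realType) := TopCtModType {
  tcm_pre :> preTopCtModType R;
  tcm_add_continuous : continuous (fun z : tcm_pre * tcm_pre => z.1 + z.2);
  tcm_scale_continuous : continuous (fun z : Ct R * tcm_pre => z.1 *: z.2)
}.

Definition metrizable (R : realType) (T : topologicalType) : Prop :=
  exists d : T -> T -> R,
    [/\ forall x y, d x y = 0 <-> x = y,
        forall x y, d x y = d y x,
        forall x y z, d x z <= d x y + d y z
      & forall x, nbhs x = filter_from [set r | 0 < r]
                                       (fun r => [set y | d x y < r])].

(* Completeness refers to the uniformity of the additive topological group: F is
   Cauchy when it contains sets that are small of order U for every neighborhood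
   U of 0. *)
Definition group_cauchy (R : realType) (G : topCtModType R) (F : set_system G) : Prop :=
  forall U, nbhs (0 : G) U -> exists2 A, F A &
    forall x y, A x -> A y -> U (x - y).

Definition group_complete (R : realType) (G : topCtModType R) : Prop :=
  forall F : set_system G, ProperFilter F -> group_cauchy F -> exists x : G, F --> x.

Section kernel_quotient.
Variables (R : realType) (G F : topCtModType R) (T : {linear G -> F}).

Definition kernel : {pred G} := fun x => T x == 0.

Lemma kernelE x : (x \in kernel) = (T x == 0). Proof. by []. Qed.

Lemma kernel_zmod_closed : zmod_closed kernel.
Proof.
split=> [|x y]; rewrite !kernelE ?raddf0//.
by move=> /eqP x0 /eqP y0; rewrite raddfB /= x0 y0 subrr.
Qed.
HB.instance Definition _ := GRing.isZmodClosed.Build G kernel kernel_zmod_closed.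

Definition quot_ker : Type := Quotient.quot kernel.
HB.instance Definition _ := GRing.Zmodule.on quot_ker.
HB.instance Definition _ := EqQuotient.on quot_ker.


Lemma pi_kernel x y : x = y %[mod quot_ker] <-> T x = T y.
Proof.
have -> : (x = y %[mod quot_ker]) <-> (x - y \in kernel).
  by rewrite Quotient.idealrBE; split=> /eqP.
by rewrite kernelE raddfB subr_eq0; split=> /eqP.
Qed.

Lemma repr_pi x : T (repr (\pi_quot_ker x)) = T x.
Proof. by apply/pi_kernel; rewrite reprK. Qed.

Definition quot_scale (a : Ct R) (q : quot_ker) : quot_ker :=
  \pi_quot_ker (a *: repr q).

Lemma pi_scale a x : quot_scale a (\pi_quot_ker x) = \pi_quot_ker (a *: x).
Proof. by apply/pi_kernel; rewrite !linearZ /= repr_pi. Qed.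

Lemma quot_scaleA a b q : quot_scale a (quot_scale b q) = quot_scale (a * b) q.
Proof. by elim/quotW: q => x; rewrite (pi_scale b) !pi_scale scalerA. Qed.

Lemma quot_scale1 : left_id 1 quot_scale.
Proof. by elim/quotW => x; rewrite pi_scale scale1r. Qed.

Lemma quot_scaleDr : right_distributive quot_scale +%R.
Proof.
move=> a; elim/quotW => x; elim/quotW => y.
rewrite -(raddfD \pi_quot_ker) !pi_scale -(raddfD \pi_quot_ker).
by rewrite scalerDr.
Qed.

Lemma quot_scaleDl q : {morph quot_scale^~ q : a b / a + b}.
Proof. by elim/quotW: q => x a b; rewrite !pi_scale -(raddfD \pi_quot_ker) scalerDl. Qed.

HB.instance Definition _ := GRing.Zmodule_isLmodule.Build (Ct R) quot_ker
  quot_scaleA quot_scale1 quot_scaleDr quot_scaleDl.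

Definition pre_quot_mod : preTopCtModType R := @PreTopCtModType R quot_ker
  (@quotient_open G quot_ker) (@openT (quotient_topology quot_ker))
  (@openI (quotient_topology quot_ker))
  (fun I f h => @bigcup_open (quotient_topology quot_ker) I setT f (fun i _ => h i)).


Definition quot_pi (x : G) : pre_quot_mod := \pi_quot_ker x.

Lemma quot_pi_surj q : exists x, quot_pi x = q.
Proof. by exists (repr (q : quot_ker)); exact: reprK. Qed.

Lemma quot_piD x y : quot_pi (x + y) = quot_pi x + quot_pi y.
Proof. exact: (raddfD \pi_quot_ker). Qed.

Lemma quot_piZ a x : quot_pi (a *: x) = a *: quot_pi x.
Proof. by symmetry; exact: pi_scale. Qed.

Lemma quot_pi_continuous : continuous quot_pi.
Proof. by apply/continuousP => A. Qed.

Lemma quot_pi_nbhs x A : nbhs x A -> nbhs (quot_pi x) (quot_pi @` A).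
Proof.
rewrite nbhsE => -[B [oB Bx] BA].
apply: (@filterS _ (nbhs (quot_pi x)) _ (quot_pi @` B)).
  exact: image_subset.
apply: open_nbhs_nbhs; split; last by exists x.
suff : open (quot_pi @^-1` (quot_pi @` B)) by [].
rewrite openE => y [b Bb bypi]; rewrite /interior.
have Ty : T b = T y by apply/pi_kernel.
have nB : nbhs (y + (b - y)) B.
  by apply: open_nbhs_nbhs; split=> //; rewrite addrC subrK.
have [[C D] /= [Cy Dby] CDB] := @tcm_add_continuous _ G (y, b - y) _ nB.
have {}nB : nbhs y ((fun z : G => z + (b - y)) @^-1` B).
  apply: filterS Cy => z Cz; apply: (CDB (z, b - y)); split=> //=.
  exact: nbhs_singleton.
apply: filterS nB => z /= Bz; exists (z + (b - y)) => //.
by apply/pi_kernel; rewrite raddfD raddfB /= Ty subrr addr0.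
Qed.

Lemma quot_add_continuous :
  continuous (fun z : pre_quot_mod * pre_quot_mod => z.1 + z.2).
Proof.
case=> p q U /=; have [x <-] := quot_pi_surj p; have [y <-] := quot_pi_surj q.
rewrite -quot_piD => /quot_pi_continuous.
move=> /(@tcm_add_continuous _ G (x, y))[[A B] /= [Ax By] AB].
exists (quot_pi @` A, quot_pi @` B); first by split; exact: quot_pi_nbhs.
move=> [_ _] /= [[a Aa <-] [b Bb <-]]; rewrite -quot_piD.
exact: (AB (a, b)).
Qed.

Lemma quot_scale_continuous :
  continuous (fun z : Ct R * pre_quot_mod => z.1 *: z.2).
Proof.
case=> c q U /=; have [x <-] := quot_pi_surj q.
rewrite -quot_piZ => /quot_pi_continuous.
move=> /(@tcm_scale_continuous _ G (c, x))[[A B] /= [Ac Bx] AB].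
exists (A, quot_pi @` B); first by split=> //; exact: quot_pi_nbhs.
move=> [a _] /= [Aa [b Bb <-]]; rewrite -quot_piZ.
exact: (AB (a, b)).
Qed.

(* G / Ker T with the quotient topology. *)
Definition quot_mod : topCtModType R :=
  TopCtModType quot_add_continuous quot_scale_continuous.

Definition quot_map_fun (q : quot_mod) : F := T (repr (q : quot_ker)).

Lemma quot_map_pi x : quot_map_fun (quot_pi x) = T x.
Proof. exact: repr_pi. Qed.

Lemma quot_map_linear : linear quot_map_fun.
Proof.
move=> a p q; have [x <-] := quot_pi_surj p; have [y <-] := quot_pi_surj q.
have -> : a *: (quot_pi x : quot_mod) + (quot_pi y : quot_mod) =
  quot_pi (a *: x + y) by rewrite quot_piD quot_piZ.
by rewrite !quot_map_pi linearP.
Qed.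

HB.instance Definition _ :=
  GRing.isLinear.Build (Ct R) quot_mod F *:%R quot_map_fun quot_map_linear.

(* The injection G / Ker T -> F associated with T, x + Ker T |-> T x. *)
Definition quot_map : {linear quot_mod -> F} := quot_map_fun.

End kernel_quotient.

Section image.
Variables (R : realType) (E F : topCtModType R) (S : {linear E -> F}).

Definition image_pred : {pred F} := fun y => `[< exists x, S x = y >].

Lemma image_predP y : reflect (exists x, S x = y) (y \in image_pred).
Proof. exact: asboolP. Qed.

Lemma image_submod_closed : submod_closed image_pred.
Proof.
split; first by apply/image_predP; exists 0; rewrite raddf0.
move=> a _ _ /image_predP[x <-] /image_predP[y <-]; apply/image_predP.
by exists (a *: x + y); rewrite linearP.
Qed.
HB.instance Definition _ :=
  GRing.isSubmodClosed.Build (Ct R) F image_pred image_submod_closed.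

Definition image_sub : Type := {y : F | y \in image_pred}.
HB.instance Definition _ := SubChoice.on image_sub.
HB.instance Definition _ := [SubChoice_isSubLmodule of image_sub by <:].

Let W := initial_topology (val : image_sub -> F).

Definition pre_image_mod : preTopCtModType R := @PreTopCtModType R image_sub
  (@open W) (@openT W) (@openI W)
  (fun I f h => @bigcup_open W I setT f (fun i _ => h i)).

Lemma image_nbhs (y : pre_image_mod) U :
  nbhs y U <-> exists2 V, nbhs (val y : F) V & forall z, V (val z) -> U z.
Proof.
split.
  rewrite nbhsE => -[B [[V oV <-] By] BU]; exists V; last by move=> z /BU.
  exact: open_nbhs_nbhs.
rewrite nbhsE => -[V [B [oB By] BV] VU].
apply: (@filterS _ (nbhs y) _ (val @^-1` B)); first by move=> z /BV/VU.
by apply: open_nbhs_nbhs; split=> //; exists B.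
Qed.

Lemma image_add_continuous :
  continuous (fun z : pre_image_mod * pre_image_mod => z.1 + z.2).
Proof.
case=> p q U /= /image_nbhs[V]; rewrite raddfD => nV VU.
have [[A B] /= [Ap Bq] AB] := @tcm_add_continuous _ F (val p, val q) _ nV.
exists (val @^-1` A, val @^-1` B).
  by split; apply/image_nbhs; [exists A|exists B].
by move=> [a b] /= [Aa Bb]; apply: VU; rewrite raddfD; exact: (AB (val a, val b)).
Qed.

Lemma image_scale_continuous :
  continuous (fun z : Ct R * pre_image_mod => z.1 *: z.2).
Proof.
case=> c q U /= /image_nbhs[V]; rewrite linearZ => nV VU.
have [[A B] /= [Ac Bq] AB] := @tcm_scale_continuous _ F (c, val q) _ nV.
exists (A, val @^-1` B); first by split => //; apply/image_nbhs; exists B.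
by move=> [a b] /= [Aa Bb]; apply: VU; rewrite linearZ; exact: (AB (a, val b)).
Qed.

(* S(E) with the topology induced by F. *)
Definition image_mod : topCtModType R :=
  TopCtModType image_add_continuous image_scale_continuous.

Lemma corestrict_proof x : S x \in image_pred.
Proof. by apply/image_predP; exists x. Qed.

Definition corestrict_fun (x : E) : image_mod := exist _ (S x) (corestrict_proof x).

Lemma corestrict_linear : linear corestrict_fun.
Proof. by move=> a x y; apply: val_inj; rewrite /= linearP. Qed.

HB.instance Definition _ :=
  GRing.isLinear.Build (Ct R) E image_mod *:%R corestrict_fun corestrict_linear.

Definition corestrict : {linear E -> image_mod} := corestrict_fun.

End image.

Definition isomorphism (R : realType) (E F : topCtModType R)
    (S : {linear E -> F}) : Prop :=
  continuous S /\
  exists S' : F -> E, [/\ cancel S S', cancel S' S & continuous S'].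

Definition strict_injection (R : realType) (E F : topCtModType R)
    (S : {linear E -> F}) : Prop := isomorphism (corestrict S).

Definition strict_morphism (R : realType) (G F : topCtModType R)
    (T : {linear G -> F}) : Prop := strict_injection (quot_map T).

(* Main.v *)
Require Import Defs.
From mathcomp Require Import all_boot all_order all_algebra.
From mathcomp Require Import all_classical all_reals all_analysis.
From mathcomp Require Import ring_quotient complex.

Set Implicit Arguments.
Unset Strict Implicit.
Unset Printing Implicit Defensive.

Import Order.TTheory GRing.Theory Num.Theory.

Local Open Scope classical_set_scope.
Local Open Scope ring_scope.
Local Open Scope quotient_scope.

(** Banach's open mapping argument goes through without a norm, because the
    topology of each module comes from a group structure with a countable base
    of neighborhoods of zero, and because the scalars contain arbitrarily small
    units, the classes [eps_pow n] of the nets eps^n.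

    For a neighborhood [V] of zero in the source, each [x] satisfies
    [eps_pow n *: x \in V] for some [n] ([absorbing]).  Hence the target is the
    union over [n] of the preimages of the closure of [T @` V] under
    multiplication by [eps_pow n].  By Baire's theorem ([baire_group]) one of
    these closed sets has an interior point; since [eps_pow n] is invertible,
    the closure of [T @` V] has one too, and subtracting it shows that the
    closure of [T @` U] is a neighborhood of zero whenever [U] contains
    [V - V] ([almost_open]).

    Completeness of the source removes the closure ([open_of_almost_open]): a
    point [y] close to zero is approximated by some [T w] with [w] small, the
    error is approximated in the same way by a still smaller vector, and so on;
    the series of these corrections converges to a preimage of [y] inside [U].
    Thus [T] is open, and for a continuous surjection openness says exactly
    that the inverse of the induced bijection from the quotient by the kernel
    is continuous ([strict_of_open]).

    Both Baire's theorem and the correction series rely on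
    [telescoping_cvg], which plays the role of the convergence of series with
    geometrically decreasing terms. *)

(** * Dependent choice *)

(** The stage occurs in [P] and [E] because the constructions below shrink the
    stage [n] neighborhood into the [n]th member of a base, or avoid the [n]th
    closed set. *)
Lemma dependent_choice_inv (X : Type) (P : nat -> X -> Prop)
    (E : nat -> X -> X -> Prop) (x0 : X) :
  P 0 x0 -> (forall n x, P n x -> exists2 y, P n.+1 y & E n x y) ->
  exists f : nat -> X, [/\ f 0 = x0, forall n, P n (f n)
    & forall n, E n (f n) (f n.+1)].
Proof.
move=> P0 step.
have /choice[g gP] (p : nat * X) :
    exists y, P p.1 p.2 -> P p.1.+1 y /\ E p.1 p.2 y.
  case: (pselect (P p.1 p.2)) => [/step[y Py Ey]|nP]; last by exists p.2.
  by exists y.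
pose f := fix f n := if n is m.+1 then g (m, f m) else x0.
have fP n : P n (f n) by elim: n => //= n /(gP (n, f n))[].
by exists f; split=> // n; have /(gP (n, f n))[] := fP n.
Qed.

(** * Neighborhoods of zero in a topological module *)

Section module_topology.
Variables (R : realType) (G : topCtModType R).
Implicit Types (x y z : G) (U V : set G).

Lemma tcm_cvgD (I : Type) (D : set_system I) (FD : Filter D) (f g : I -> G) (a b : G) :
  f @ D --> a -> g @ D --> b -> (fun i => f i + g i) @ D --> a + b.
Proof.
move=> fa gb; apply: (@continuous2_cvg I G G G D FD f g (fun x y => x + y) a b) => //.
exact: (@tcm_add_continuous _ G (a, b)).
Qed.

Lemma tcm_cvgZ (I : Type) (D : set_system I) (FD : Filter D) (c : Ct R)
    (g : I -> G) (b : G) :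
  g @ D --> b -> (fun i => c *: g i) @ D --> c *: b.
Proof.
move=> gb; apply: (@continuous2_cvg I (Ct R) G G D FD (fun=> c) g
  (fun (c : Ct R) (x : G) => c *: x) c b) => //; last exact: cvg_cst.
exact: (@tcm_scale_continuous _ G (c, b)).
Qed.

Lemma tcm_cvgB (I : Type) (D : set_system I) (FD : Filter D) (f g : I -> G) (a b : G) :
  f @ D --> a -> g @ D --> b -> (fun i => f i - g i) @ D --> a - b.
Proof.
move=> fa gb; apply: tcm_cvgD => //.
rewrite -scaleN1r (_ : (fun i => - g i) = (fun i => (-1) *: g i)).
  exact: tcm_cvgZ.
by apply/funext => i; rewrite scaleN1r.
Qed.

Lemma nbhs0_shift x U : nbhs x U -> nbhs (0 : G) [set w | U (x + w)].
Proof.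
move=> xU; have : (fun w => x + w) @ (0 : G) --> x + 0.
  by apply: (@tcm_cvgD G (nbhs (0 : G)) _ (fun=> x) id);
    [exact: cvg_cst|exact: cvg_id].
by rewrite addr0; apply.
Qed.

Lemma nbhs_shift x U : nbhs (0 : G) U -> nbhs x [set z | U (z - x)].
Proof.
move=> U0; have : (fun z => z - x) @ x --> x - x.
  by apply: (@tcm_cvgB G (nbhs x) _ id (fun=> x));
    [exact: cvg_id|exact: cvg_cst].
by rewrite subrr; apply.
Qed.

Lemma nbhs_reflect x U : nbhs (0 : G) U -> nbhs x [set z | U (x - z)].
Proof.
move=> U0; have : (fun z => x - z) @ x --> x - x.
  by apply: (@tcm_cvgB G (nbhs x) _ (fun=> x) id);
    [exact: cvg_cst|exact: cvg_id].
by rewrite subrr; apply.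
Qed.

Lemma nbhs0_sub U : nbhs (0 : G) U ->
  exists2 V, nbhs (0 : G) V & forall a b, V a -> V b -> U (a - b).
Proof.
move=> U0; have := @tcm_cvgB (G * G)%type (nbhs (0 : G, 0 : G))
  (nbhs_filter (0 : G, 0 : G)) fst snd 0 0
  (@cvg_fst G G (nbhs (0 : G)) (nbhs (0 : G)) (nbhs_filter (0 : G)))
  (@cvg_snd G G (nbhs (0 : G)) (nbhs (0 : G)) (nbhs_filter (0 : G))).
rewrite subrr => /(_ _ U0)[[A B] /= [A0 B0] AB].
exists (A `&` B); first exact: filterI.
by move=> a b [Aa _] [_ Bb]; exact: (AB (a, b)).
Qed.

Lemma nbhs0_add U : nbhs (0 : G) U ->
  exists2 V, nbhs (0 : G) V & forall a b, V a -> V b -> U (a + b).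
Proof.
move=> /nbhs0_sub[V V0 VU]; have [W W0 WV] := nbhs0_sub V0.
exists (V `&` W); first exact: filterI.
move=> a b [Va _] [_ Wb]; rewrite -(opprK b); apply: (VU) => //.
by rewrite -sub0r; apply: WV => //; exact: nbhs_singleton.
Qed.

Lemma nbhs0_add3 U : nbhs (0 : G) U -> exists2 V, nbhs (0 : G) V &
  forall a b c, V a -> V b -> V c -> U (a + b + c).
Proof.
move=> /nbhs0_add[V V0 VU]; have [W W0 WV] := nbhs0_add V0.
exists (V `&` W); first exact: filterI.
by move=> a b c [_ Wa] [_ Wb] [Vc _]; apply: VU => //; exact: WV.
Qed.

Lemma metrizable_nbhs0_base : metrizable R G -> exists B : nat -> set G,
  (forall n, nbhs (0 : G) (B n)) /\
  (forall U, nbhs (0 : G) U -> exists n, B n `<=` U).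
Proof.
case=> d [_ _ _ nbhsd]; exists (fun n => [set y | d 0 y < n.+1%:R^-1]); split.
  by move=> n; rewrite nbhsd; exists n.+1%:R^-1 => //=; rewrite invr_gt0.
move=> U; rewrite nbhsd => -[r /= r0 rU].
have [n _ nr] := near_infty_natSinv_lt (PosNum r0).
by exists n => y /= dy; apply: rU; rewrite /= (lt_trans dy)//; exact: nr n (leqnn n).
Qed.

Lemma metrizable_separated : metrizable R G ->
  forall x, (forall U, nbhs (0 : G) U -> U x) -> x = 0.
Proof.
case=> d [d0 dC dtri nbhsd] x xU; apply/esym/d0/eqP; rewrite eq_le.
have d00 : d 0 0 = 0 by apply/d0.
apply/andP; split; last first.
  have := dtri 0 x 0; rewrite (dC x 0) d00 -mulr2n.
  by rewrite pmulrn_lge0.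
rewrite leNgt; apply/negP => dx.
suff : d 0 x < d 0 x by rewrite ltxx.
by apply: (xU [set y | d 0 y < d 0 x]); rewrite nbhsd; exists (d 0 x).
Qed.

(** * Completeness and Baire's theorem *)

(** The condition on [W] says that each [W n.+1] has at most a third of the size
    of [W n].  As 1 + 1/3 + 1/9 + ... < 2, all partial sums of increments from
    stage [n] on fit in [W n + W n]. *)
Lemma telescoping_bound (u : nat -> G) (W : nat -> set G) :
  (forall n, nbhs (0 : G) (W n)) ->
  (forall n a b c, W n.+1 a -> W n.+1 b -> W n.+1 c -> W n (a + b + c)) ->
  (forall n, W n (u n.+1 - u n)) ->
  forall n k, exists a b, [/\ W n a, W n b & u (n + k)%N = u n + a + b].
Proof.
move=> W0 W3 uW n k; have W00 m : W m 0 by exact: nbhs_singleton.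
elim: k n => [|k IH] n; first by exists 0, 0; rewrite addn0 !addr0.
have [a [b [Wa Wb uab]]] := IH n.+1.
exists (u n.+1 - u n), (a + b); split; first exact: uW.
  by rewrite -(addr0 (a + b)); exact: W3.
by rewrite addnS -addSn uab addrA (addrC (u n)) subrK.
Qed.

(** The limit stays in the same set [u n + W n + W n] as the partial sums, with
    no closure taken: the slack between 1 + 1/3 + ... = 3/2 and 2 absorbs the
    distance from a late term to the limit. *)
Lemma telescoping_cvg (u : nat -> G) (W : nat -> set G) :
  group_complete G ->
  (forall n, nbhs (0 : G) (W n)) ->
  (forall n a b c, W n.+1 a -> W n.+1 b -> W n.+1 c -> W n (a + b + c)) ->
  (forall U, nbhs (0 : G) U -> exists n, W n `<=` U) ->
  (forall n, W n (u n.+1 - u n)) ->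
  exists x, forall n, exists a b, [/\ W n a, W n b & x = u n + a + b].
Proof.
move=> Gc W0 W3 Wbase uW; have W00 m : W m 0 by exact: nbhs_singleton.
have tail := telescoping_bound W0 W3 uW.
have Wtail n m : (n < m)%N -> W n (u m - u n.+1).
  move=> nm; have [a [b [Wa Wb]]] := tail n.+1 (m - n.+1)%N.
  rewrite subnKC// => ->; rewrite -(addrA (u _)) (addrC (u _)) addrK -(addr0 (a + b)).
  exact: W3.
have [x ux] : exists x : G, u @ \oo --> x.
  apply: Gc => U /nbhs0_sub[V /Wbase[n WV] VU].
  exists [set z | W n (z - u n.+1)]; first by exists n.+1 => // m /= /Wtail.
  move=> y z /= /WV Vy /WV Vz.
  by rewrite -(subrKA (u n.+1)) -(opprB z); exact: VU.
exists x => n.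
have [N _ NW] := ux _ (nbhs_reflect x (W0 n.+1)).
have [a [b [Wa Wb uab]]] := tail n.+1 N.
(* The last increment x - u (n.+1 + N) only has to be in W n.+1. *)
exists (u n.+1 - u n), (a + b + (x - u (n.+1 + N)%N)); split => //.
  by apply: W3 => //; apply: NW => /=; exact: leq_addl.
by rewrite (addrC (u n)) subrK addrA (addrA _ a b) -uab addrC subrK.
Qed.

(** Baire's theorem, from completeness of the group uniformity: a compatible
    metric need not be complete, so balls are replaced by translates of
    shrinking neighborhoods of zero.  If no [C n] has an interior point, one
    chooses points [y n.+1 \in y n + W n] outside [C n] together with
    [W n.+1] so small that [y n.+1 + W n.+1 + W n.+1] misses [C n]; the limit of
    [y] is then in no [C n]. *)
Lemma baire_group (B : nat -> set G) (C : nat -> set G) :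
  group_complete G ->
  (forall n, nbhs (0 : G) (B n)) ->
  (forall U, nbhs (0 : G) U -> exists n, B n `<=` U) ->
  (forall n, closed (C n)) -> (forall x, exists n, C n x) ->
  exists n x, nbhs x (C n).
Proof.
move=> Gc B0 Bbase Ccl Ccover; apply: contrapT => noint.
(* A state s is a point s.1 with the neighborhood s.2 allowed for the next
   increment. *)
pose P (n : nat) (s : G * set G) := nbhs (0 : G) s.2 /\ s.2 `<=` B n.
pose E (n : nat) (s t : G * set G) := [/\ s.2 (t.1 - s.1),
  forall a b c, t.2 a -> t.2 b -> t.2 c -> s.2 (a + b + c)
  & forall a b, t.2 a -> t.2 b -> ~ C n (t.1 + a + b)].
have [|n [y W] [/= W0 _]|f [_ fP fE]] := @dependent_choice_inv _ P E (0, B 0%N).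
- by split; [exact: B0|exact: subset_refl].
- have [z [Wzy nCz]] : exists z, W (z - y) /\ ~ C n z.
    apply: contrapT => noz; apply: noint; exists n, y.
    apply: filterS (nbhs_shift y W0) => z /= Wz; apply: contrapT => nCz.
    by apply: noz; exists z.
  have zC : nbhs z (~` C n).
    by apply: open_nbhs_nbhs; split=> //; exact: closed_openC.
  have [V V0 VW] := nbhs0_add3 W0.
  have [V' V'0 V'C] := nbhs0_add (nbhs0_shift zC).
  exists (z, V `&` V' `&` B n.+1); split => //=.
  + by do 2?[apply: filterI].
  + by move=> a b c [[? _] _] [[? _] _] [[? _] _]; exact: VW.
  + by move=> a b [[_ ?] _] [[_ ?] _]; rewrite -addrA; exact: V'C.
pose u n := (f n).1; pose W n := (f n).2.
have [||||x xW] := @telescoping_cvg u W Gc.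
- by move=> n; have [] := fP n.
- by move=> n; have [] := fE n.
- move=> U /Bbase[n BU]; exists n; apply: subset_trans BU.
  by have [] := fP n.
- by move=> n; have [] := fE n.
have [n Cx] := Ccover x; have [a [b [Wa Wb xab]]] := xW n.+1.
by have [_ _ /(_ a b Wa Wb)] := fE n; rewrite -/(u _) -xab.
Qed.

End module_topology.

(** * Arbitrarily small units of the ring of scalars *)

Section small_units.
Variable R : realType.

Definition eps_net (z : int) : net R := fun e => (val e ^ z)%:C%C.

Lemma netO_eps (z : int) : netO (eps_net z) z%:~R.
Proof.
apply/netOP; exists 1 => //; exists 1 => // e _.
rewrite mul1r powR_intmul ?(ltW (eps_index_gt0 e))// /eps_net.
rewrite /normc /= expr0n addr0 sqrtr_sqr ger0_norm// exprz_ge0//.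
exact: ltW (eps_index_gt0 e).
Qed.

Lemma moderate_eps z : eps_net z \in @moderate R.
Proof.
apply/moderateP; exists `|z|%N; apply: netO_le (netO_eps z).
by rewrite natr_absz -mulrNz ler_int lerNl -normrN ler_norm.
Qed.

Definition eps_EM z : Defs.EM R := exist _ (eps_net z) (moderate_eps z).

Definition eps_pow z : Ct R := \pi_(Ct R) (eps_EM z).

Lemma eps_powM z : eps_pow z * eps_pow (- z) = 1.
Proof.
rewrite /eps_pow -(rmorphM \pi_(Ct R)) -(rmorph1 \pi_(Ct R)); congr (\pi _).
apply: val_inj; apply/funext => e /=.
transitivity (eps_net z e * eps_net (- z) e) => //.
by rewrite /eps_net -rmorphM /= -expfzDr ?gt_eqF ?eps_index_gt0// subrr.
Qed.

Lemma enorm_eps_pow (n : nat) : enorm (eps_pow n) <= expR (- n%:R).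
Proof.
rewrite -lee_fin enormE -[leRHS]/(expeR (- n%:R%:E)) lee_expeR leeN2.
rewrite valuation_pi; 
exact: (@le_valuation _ (eps_EM n) n%:R (netO_eps n)).
Qed.

Lemma eps_pow_small (A : set (Ct R)) : nbhs (0 : Ct R) A ->
  exists n : nat, A (eps_pow n).
Proof.
move=> /nbhs_ballP[r /= r0 rA].
have [n _ nr] := near_infty_natSinv_lt (PosNum r0).
exists n; apply: rA; rewrite Ct_ballE /= sub0r enormN.
apply: le_lt_trans (enorm_eps_pow n) _; apply: le_lt_trans (nr n (leqnn n)).
rewrite expRN lef_pV2 ?posrE ?expR_gt0 ?ltr0Sn//.
by rewrite -natr1 addrC expR_ge1Dx.
Qed.

(** Neighborhoods of zero absorb points: [eps_pow n *: x] tends to zero. *)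
Lemma absorbing (G : topCtModType R) (x : G) (U : set G) :
  nbhs (0 : G) U -> exists n : nat, U (eps_pow n *: x).
Proof.
move=> U0; have := @tcm_scale_continuous _ G (0, x) U; rewrite /= scale0r.
case/(_ U0) => -[A B] /= [/eps_pow_small[n An] Bx] AB.
by exists n; apply: (AB (_, x)); split=> //; exact: nbhs_singleton.
Qed.

End small_units.

(** * The open mapping theorem *)

Section open_mapping.
Variables (R : realType) (G F : topCtModType R) (T : {linear G -> F}).

(** Surjectivity makes the dilates of [T @` V] cover the target when [V] is a
    neighborhood of zero, and completeness of the target lets Baire's theorem
    find one whose closure has an interior point. *)
Lemma almost_open (U : set G) :
  metrizable R F -> group_complete F -> (forall y, exists x, T x = y) ->
  nbhs (0 : G) U -> nbhs (0 : F) (closure (T @` U)).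
Proof.
move=> /metrizable_nbhs0_base[B [B0 Bbase]] Fc Tsurj /nbhs0_sub[V V0 VU].
pose C n : set F := (fun y => eps_pow R n *: y) @^-1` closure (T @` V).
have [||n [y yC]] := baire_group Fc B0 Bbase (C := C).
- move=> n; apply: closed_comp; last exact: closed_closure.
  move=> y _; apply: (@tcm_cvgZ R F F (nbhs y) (nbhs_filter y) _ id); exact: cvg_id.
- move=> y; have [x <-] := Tsurj y; have [n Vx] := absorbing x V0.
  by exists n; apply: subset_closure; exists (eps_pow R n *: x); rewrite ?linearZ.
have Cy : closure (T @` V) (eps_pow R n *: y) := nbhs_singleton yC.
(* Dilating by the inverse of eps_pow n turns the interior point y of C n into
   the interior point eps_pow n *: y of the closure of T @` V. *)
have : (fun z : F => y + eps_pow R (- n%:Z) *: z) @ (0 : F) -->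
    y + eps_pow R (- n%:Z) *: 0.
  apply: (@tcm_cvgD R F F (nbhs (0 : F)) _ (fun=> y)).
    exact: (@cvg_cst F y F (nbhs (0 : F)) _).
  exact: (@tcm_cvgZ R F F (nbhs (0 : F)) (nbhs_filter (0 : F))
    (eps_pow R (- n%:Z)) id 0 cvg_id).
rewrite scaler0 addr0 => /(_ _ yC); apply: (@filterS F (nbhs (0 : F)) _) => z.
rewrite /C /= scalerDr scalerA eps_powM scale1r => Cyz O zO.
have : (fun p : F * F => p.1 - p.2) @
    (eps_pow R n *: y + z, eps_pow R n *: y) --> z.
  rewrite -[X in _ --> X](addrK (eps_pow R n *: y)) (addrC z).
  apply: (@tcm_cvgB R F (F * F)%type (nbhs (_, _)) _ fst snd).
  - exact: (@cvg_fst F F (nbhs _) (nbhs _) (nbhs_filter _)).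
  - exact: (@cvg_snd F F (nbhs _) (nbhs _) (nbhs_filter _)).
move=> /(_ _ zO)[[P Q] /= [/Cyz[_ [[a Va <-] Pa]] /Cy[_ [[b Vb <-] Qb]]] PQ].
exists (T a - T b); split; last exact: (PQ (_, _)).
by exists (a - b); [exact: VU|rewrite raddfB].
Qed.

(** Successive approximation.  The approximate preimages [u n] of [y] keep the
    error [y - T (u n)] in the closure of [T @` W n]; this closure is a
    neighborhood of zero, which is what allows the next correction to be found
    in [W n]. *)
Lemma open_of_almost_open :
  metrizable R G -> group_complete G -> metrizable R F -> continuous T ->
  (forall U, nbhs (0 : G) U -> nbhs (0 : F) (closure (T @` U))) ->
  forall U, nbhs (0 : G) U -> nbhs (0 : F) (T @` U).
Proof.
move=> /metrizable_nbhs0_base[B [B0 Bbase]] Gc /metrizable_separated Fsep Tc.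
move=> aopen U U0; have [U' U'0 U'U] := nbhs0_add U0.
pose P (n : nat) (W : set G) := nbhs (0 : G) W /\ W `<=` B n.
pose E (n : nat) (W W' : set G) :=
  forall a b c, W' a -> W' b -> W' c -> W (a + b + c).
have [|n W [W0 _]|W [W0 WP WE]] := @dependent_choice_inv _ P E (U' `&` B 0%N).
- by split; [exact: filterI|exact: subIsetr].
- have [V V0 VW] := nbhs0_add3 W0.
  exists (V `&` B n.+1); first by split; [exact: filterI|exact: subIsetr].
  by move=> a b c [? _] [? _] [? _]; exact: VW.
have Wnbhs n : nbhs (0 : G) (W n) by have [] := WP n.
have Wbase O : nbhs (0 : G) O -> exists n, W n `<=` O.
  by move=> /Bbase[n BO]; exists n; apply: subset_trans BO; have [] := WP n.
apply: filterS (aopen _ (Wnbhs 0%N)) => y yW.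
pose Q n (u : G) := closure (T @` W n) (y - T u).
have [||u [u0 uQ uW]] := @dependent_choice_inv _ Q (fun n u v => W n (v - u)) 0.
- by rewrite /Q raddf0 subr0.
- move=> n u /= Qu.
  have [_ [[w Ww <-] /= yuw]] := Qu _ (nbhs_reflect _ (aopen _ (Wnbhs n.+1))).
  exists (u + w); last by rewrite addrC addKr.
  by rewrite /Q raddfD opprD addrA.
have [x xW] := telescoping_cvg Gc Wnbhs WE Wbase uW.
exists x.
  have [a [b [Wa Wb ->]]] := xW 0%N; rewrite u0 add0r.
  by move: Wa Wb; rewrite W0 => -[? _] [? _]; exact: U'U.
(* Continuity of T makes y - T x arbitrarily small: it is T of a vector of
   W m.+1 - (W m.+1 + W m.+1), up to the error made in approximating a point of
   the closure of T @` W m.+1. *)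
apply/eqP; rewrite eq_sym -subr_eq0; apply/eqP; apply: Fsep => O.
move=> /nbhs0_add[N N0 NO].
have : nbhs (0 : G) (T @^-1` N) by apply: Tc; rewrite raddf0.
move=> /nbhs0_sub[V V0 VN]; have [m WV] := Wbase _ V0.
have W00 n : W n 0 by exact: nbhs_singleton.
have [a [b [Wa Wb ->]]] := xW m.+1.
have [_ [[w Ww <-] /= yuw]] := uQ m.+1 _ (nbhs_reflect _ N0).
have -> : y - T (u m.+1 + a + b) = (y - T (u m.+1) - T w) + T (w - (a + b)).
  by rewrite raddfB addrA subrK -addrA raddfD opprD addrA.
apply: NO yuw (VN _ _ (WV _ _) (WV _ _)).
  by rewrite -(addr0 w) -(addr0 (w + 0)); exact: WE.
by rewrite -(addr0 (a + b)); exact: WE.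
Qed.

Lemma open_mapping :
  metrizable R G -> group_complete G -> metrizable R F -> group_complete F ->
  continuous T -> (forall y, exists x, T x = y) ->
  forall x U, nbhs x U -> nbhs (T x) (T @` U).
Proof.
move=> Gm Gc Fm Fc Tc Tsurj x U xU.
have Topen := open_of_almost_open Gm Gc Fm Tc
  (fun U => @almost_open U Fm Fc Tsurj).
apply: filterS (nbhs_shift (T x) (Topen _ (nbhs0_shift xU))) => y /= [w Uw Tw].
by exists (x + w) => //; rewrite raddfD /= Tw addrC subrK.
Qed.

(** [T] factors as the quotient map followed by the induced bijection, so
    preimages under the inverse of that bijection are images under [T] of
    preimages under the quotient map. *)
Lemma strict_of_open :
  continuous T -> (forall y, exists x, T x = y) ->
  (forall x U, nbhs x U -> nbhs (T x) (T @` U)) -> strict_morphism T.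
Proof.
move=> Tc Tsurj Topen; split.
  move=> q U; have [x <-] := quot_pi_surj q.
  move=> /image_nbhs[V]; rewrite /= quot_map_pi => /Tc xV VU.
  have := quot_pi_nbhs T xV; apply: filterS => _ [z Vz <-].
  by apply: VU; rewrite /= quot_map_pi.
have /choice[s sK] := Tsurj.
exists (fun y => quot_pi T (s (val y))); split.
- move=> q; have [x <-] := quot_pi_surj q.
  by apply/pi_kernel; rewrite sK /= quot_map_pi.
- by move=> y; apply: val_inj; rewrite /= quot_map_pi sK.
move=> y U /quot_pi_continuous/Topen; rewrite sK => yU.
apply/image_nbhs; exists (T @` (quot_pi T @^-1` U)) => // z [x Ux Txz].
rewrite /= (_ : quot_pi T (s (val z)) = quot_pi T x)//.
by apply/pi_kernel; rewrite sK.
Qed.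

End open_mapping.

Theorem theorem2p9 (R : realType) (G F : topCtModType R) (T : {linear G -> F})
    (Gmetrizable : metrizable R G) (Gcomplete : group_complete G)
    (Fmetrizable : metrizable R F) (Fcomplete : group_complete F)
    (Tcontinuous : continuous T) (Tsurjective : forall y : F, exists x : G, T x = y) :
  strict_morphism T.
Proof.
by apply: strict_of_open => // x U; exact: open_mapping.
Qed.
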